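(* Let $0<\beta<\alpha$ and $L>0$, and let $\mathcal{H}$ be an infinite dimensional Hilbert space with fixed orthonormal basis $\{|j\rangle\}_{j\ge0}$. Consider the i.i.d. quantum model $\mathcal{Q}_n=\{|\psi\rangle\langle\psi|^{\otimes n}:|\psi\rangle\langle\psi|\in S^\alpha(L)\}$ and the functional $F(\psi)=\sum_{j\ge0}|\psi_j|^2j^{2\beta}$. Measure each of the $n$ copies of $|\psi\rangle$ separately with the projections $\{|j\rangle\langle j|\}_{j\ge0}$, giving i.i.d. outcomes $X_1,\dots,X_n$ with $\mathbb{P}_\psi(X_k=j)=|\psi_j|^2$, $j\ge0$; let $\hat p_j=\frac1n\sum_{k=1}^nI(X_k=j)$ and $$\widehat F_n=\sum_{j=1}^N\hat p_j\, j^{2\beta},$$ where the truncation parameter satisfies $N\asymp n^{1/(4(\alpha-\beta))}$ if $\alpha\ge2\beta$, respectively $N\asymp n^{1/(2\alpha)}$ if $\beta<\alpha<2\beta$. Then $$\sup_{\psi\in S^\alpha(L)}\mathbb{E}_\psi\left(\widehat F_n-F(\psi)\right)^2=O(\eta_n^2),\qquad \eta_n^2=\begin{cases}n^{-1},&\text{if }\alpha\ge2\beta,\\ n^{-2(1-\beta/\alpha)},&\text{if }\beta<\alpha<2\beta.\end{cases}$$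
   Context: The Hermite-Sobolev class is $S^\alpha(L)=\{|\psi\rangle\langle\psi|:\ \sum_{j=0}^\infty|\psi_j|^2j^{2\alpha}\le L,\ \|\psi\|=1\}$, where $\psi_j=\langle j|\psi\rangle$ are the coefficients in the fixed orthonormal basis; $\psi\in S^\alpha(L)$ means $|\psi\rangle\langle\psi|\in S^\alpha(L)$. $N=N_n$ is a positive integer, $a_n\asymp b_n$ means that $a_n/b_n$ is bounded above and below by positive constants, $I(\cdot)$ is the indicator, and $\mathbb{E}_\psi$ is expectation under the law of $(X_1,\dots,X_n)$ when the state is $|\psi\rangle\langle\psi|^{\otimes n}$. *)

(* Defs.v *)
From HB Require Import structures.
From mathcomp Require Import all_boot all_order all_algebra.
From mathcomp Require Import sesquilinear complex.
From mathcomp Require Import all_classical all_reals all_analysis.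

Set Implicit Arguments.
Unset Strict Implicit.
Unset Printing Implicit Defensive.

Import Order.TTheory GRing.Theory Num.Theory.
Import numFieldNormedType.Exports.

Local Open Scope classical_set_scope.
Local Open Scope ring_scope.

(* A complex Hilbert space is a complete normed module [H] over [R[i]] whose
   norm comes from a positive definite Hermitian form [dot].  Following the
   library, [dot] is linear in its first argument, so the physicists' bracket
   <u|v>, linear in v, is [dot v u]. *)
Definition hilbert_form (R : realType) (H : completeNormedModType R[i])
    (dot : {dot H for Num.conj}) : Prop :=
  forall u : H, `|u| ^+ 2 = dot u u.

(* Every vector is the norm-convergent sum of its components <j|v> |j>; since
   the family is indexed by all of [nat], [H] is infinite dimensional. *)
Definition orthonormal_basis (R : realType) (H : completeNormedModType R[i])
    (dot : {dot H for Num.conj}) (e : nat -> H) : Prop :=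
  (forall i j : nat, dot (e i) (e j) = (i == j)%:R) /\
  (forall v : H, series (fun j => dot v (e j) *: e j) @ \oo --> v).

Section tuple_mass.
Context (R : realType) (p : nat -> R).
Hypothesis p_ge0 : forall j, 0 <= p j.
Hypothesis p_sum1 : (\sum_(0 <= j <oo) (p j)%:E = 1)%E.

Lemma esum_tuple_prod n :
  (\esum_(x in [set: n.-tuple nat]) (\prod_(k < n) p (tnth x k))%:E = 1)%E.
Proof.
have prod_ge0 m (x : m.-tuple nat) : 0 <= \prod_(k < m) p (tnth x k).
  by apply: prodr_ge0.
elim: n => [|n IHn].
  rewrite (_ : [set: 0.-tuple nat] = [set [tuple]]); last first.
    by apply/seteqP; split => // x _ /=; rewrite tuple0.
  by rewrite esum_set1 ?lee_fin ?big_ord0.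
pose cns (u : n.-tuple nat * nat) : n.+1.-tuple nat := [tuple of u.2 :: u.1].
have bij_cns : set_bij [set: n.-tuple nat * nat] [set: n.+1.-tuple nat] cns.
  split => //.
    move=> [t i] [u j] _ _ /(congr1 val) [-> tu].
    by congr pair; apply: val_inj.
  by move=> x _; case/tupleP: x => j t; exists (t, j).
rewrite (reindex_esum _ _ _ _ bij_cns).
rewrite (_ : [set: n.-tuple nat * nat] =
             [set: n.-tuple nat] `*`` (fun=> [set: nat])); last first.
  by apply/seteqP; split.
rewrite -(@esum_esum _ _ _ _ _ (fun t j =>
  (\prod_(k < n.+1) p (tnth (cns (t, j)) k))%:E)); last first.
  by move=> t j _ _; rewrite lee_fin.
rewrite -IHn; apply: eq_esum => t _.
under eq_esum => j _.
  rewrite big_ord_recl tnth0/=.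
  under eq_bigr do rewrite tnthS.
  rewrite mulrC EFinM.
  over.
rewrite -nneseries_esumT; last first.
  by move=> j; apply: mule_ge0; rewrite lee_fin; [exact: prod_ge0|exact: p_ge0].
by rewrite /= nneseriesZl ?p_sum1 ?mule1// => j _; rewrite lee_fin.
Qed.

End tuple_mass.

Section model.
Context (R : realType) (H : completeNormedModType R[i]).
Variables (dot : {dot H for Num.conj}) (e : nat -> H).
Implicit Types (psi : H) (rho : H -> H) (n j : nat) (s : R).

(* |psi_j|^2 with psi_j = <j|psi>, as an element of R rather than R[i] *)
Definition coef2 psi j : R := complex.Re (`|dot psi (e j)| ^+ 2).

(* sum_j |psi_j|^2 j^(2s), possibly +oo; for s > 0 the term j = 0 vanishes,
   since 0 `^ x = 0 when x != 0 *)
Definition weighted_sum psi s : \bar R :=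
  (\sum_(0 <= j <oo) (coef2 psi j * j%:R `^ (2 * s))%:E)%E.

(* the operator |psi><psi| *)
Definition pure_state psi : H -> H := fun phi => dot phi psi *: psi.

Definition hermite_sobolev (alpha L : R) : set (H -> H) :=
  [set pure_state psi | psi in
    [set psi | (weighted_sum psi alpha <= L%:E)%E /\ `|psi| = 1]].

(* The n-fold tensor power of rho, given by its matrix in the product basis
   |x_1> ⊗ ... ⊗ |x_n> of the n-fold tensor power of H: its (x, y) entry is
   the product of the <x_k| rho |y_k>. *)
Definition tensor_power rho n (x y : n.-tuple nat) : R[i] :=
  \prod_(k < n) dot (rho (e (tnth y k))) (e (tnth x k)).

(* Born rule for measuring every copy of |psi> with the projections |j><j|:
   the probability of the outcomes x_1, ..., x_n is the trace of
   |psi><psi|^{⊗n} times |x_1><x_1| ⊗ ... ⊗ |x_n><x_n|. *)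
Definition outcome_pmf psi n (x : n.-tuple nat) : R :=
  complex.Re (tensor_power (pure_state psi) x x).

Definition outcome_law psi n (A : set (n.-tuple nat)) : \bar R :=
  (\esum_(x in A) (outcome_pmf psi x)%:E)%E.

(* The outcomes X_k = tnth x k are i.i.d. with P(X_k = j) = |psi_j|^2. *)
Lemma outcome_pmfE psi n (x : n.-tuple nat) :
  outcome_pmf psi x = \prod_(k < n) coef2 psi (tnth x k).
Proof.
rewrite /outcome_pmf /tensor_power /pure_state.
under eq_bigr => k _.
  rewrite linearZl_LR/= hermitian_subproof/= expr0 mul1r mulrC -normCK.
  rewrite -[`|_|]RRe_real ?normr_real// -rmorphXn/=.
  over.
rewrite -rmorph_prod/=; apply: eq_bigr => k _.
by rewrite /coef2 -[`|_| in RHS]RRe_real ?normr_real// -rmorphXn.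
Qed.

Lemma coef2_ge0 psi j : 0 <= coef2 psi j.
Proof.
by rewrite /coef2 -[`|_|]RRe_real ?normr_real// -rmorphXn/= sqr_ge0.
Qed.

Lemma outcome_pmf_ge0 psi n (x : n.-tuple nat) : 0 <= outcome_pmf psi x.
Proof. by rewrite outcome_pmfE prodr_ge0// => k _; exact: coef2_ge0. Qed.

Section outcome_law_measure.
Variables (psi : H) (n : nat).

Let outcome_law0 : @outcome_law psi n set0 = 0%E.
Proof. exact: esum_set0. Qed.

Let outcome_law_ge0 A : (0 <= @outcome_law psi n A)%E.
Proof. by apply: esum_ge0 => x _; rewrite lee_fin outcome_pmf_ge0. Qed.

Let outcome_law_sigma_additive : semi_sigma_additive (@outcome_law psi n).
Proof.
move=> F mF tF mUF; apply: cvg_toP.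
  apply: ereal_nondecreasing_is_cvgn => a b ab.
  by apply: lee_sum_nneg_natr => // k _ _; exact: outcome_law_ge0.
rewrite /outcome_law nneseries_sum_bigcup// => x.
by rewrite lee_fin outcome_pmf_ge0.
Qed.

HB.instance Definition _ := isMeasure.Build _ _ _ (@outcome_law psi n)
  outcome_law0 outcome_law_ge0 outcome_law_sigma_additive.

End outcome_law_measure.

Lemma parseval psi : hilbert_form dot -> orthonormal_basis dot e ->
  `|psi| = 1 -> (\sum_(0 <= j <oo) (coef2 psi j)%:E = 1)%E.
Proof.
move=> hdot [e_on e_tot] psi1.
have normS n : `|series (fun j => dot psi (e j) *: e j) n| ^+ 2
             = (\sum_(0 <= j < n) coef2 psi j)%:C%C.
  rewrite hdot /series/= linear_sumlz/= rmorph_sum/=.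
  rewrite [LHS]big_nat [RHS]big_nat; apply: eq_bigr => i /andP[_ iltn].
  rewrite linearZl_LR/= linear_sumr/=.
  rewrite (bigD1_seq i) ?mem_index_iota ?iota_uniq//=.
  rewrite [X in _ + X]big1 ?addr0 => [|j ji].
    rewrite linearZr_LR/= e_on eqxx mulr1 -normCK /coef2.
    by rewrite -[`|_|]RRe_real ?normr_real// -rmorphXn.
  by rewrite linearZr_LR/= e_on eq_sym (negbTE ji) mulr0.
pose r n := complex.Re `|series (fun j => dot psi (e j) *: e j) n|.
have rC n : (r n)%:C%C = `|series (fun j => dot psi (e j) *: e j) n|.
  by rewrite /r RRe_real ?normr_real.
have cvgr : r @ \oo --> (1 : R).
  apply/cvgrPdist_lt => eps eps0.
  have epsC : 0 < eps%:C%C :> R[i] by rewrite ltcR.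
  move: (e_tot psi) => /cvgrPdist_lt /(_ _ epsC).
  apply: filterS => n /(le_lt_trans (ler_dist_dist _ _)).
  rewrite psi1 -rC -(rmorph1 (real_complex R)) -rmorphB/= normc_def/=.
  by rewrite expr0n addr0 sqrtr_sqr ltcR.
have cvgR : series (coef2 psi) @ \oo --> (1 : R).
  rewrite (_ : series _ = r \* r); last first.
    apply/funext => n /=; apply: (@complexI R).
    by rewrite rmorphM/= rC -expr2 normS.
  by rewrite -[X in _ --> X](mulr1 1); exact: cvgM.
rewrite (_ : 1%E = (limn (series (coef2 psi)))%:E); last first.
  by rewrite (cvg_lim _ cvgR).
rewrite -EFin_lim; last by apply/cvg_ex; exists 1.
by apply/congr_lim/funext => n/=; rewrite sumEFin.
Qed.

Lemma outcome_law_setT psi n : hilbert_form dot -> orthonormal_basis dot e ->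
  `|psi| = 1 -> @outcome_law psi n [set: n.-tuple nat] = 1%E.
Proof.
move=> hdot he psi1; rewrite -(esum_tuple_prod (coef2_ge0 psi) _ n).
  by apply: eq_esum => x _; rewrite outcome_pmfE.
exact: parseval.
Qed.

Definition F_functional (beta : R) psi : \bar R := weighted_sum psi beta.

Definition p_hat n (x : n.-tuple nat) j : R :=
  n%:R^-1 * \sum_(k < n) (tnth x k == j)%:R.

Definition F_hat (beta : R) (N : nat) n (x : n.-tuple nat) : R :=
  \sum_(1 <= j < N.+1) p_hat x j * j%:R `^ (2 * beta).

Definition mse (beta : R) (N n : nat) psi : \bar R :=
  (\int[@outcome_law psi n]_x
     ((F_hat beta N x)%:E - F_functional beta psi) ^+ 2)%E.

Definition max_risk (alpha L beta : R) (N n : nat) : \bar R :=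
  ereal_sup [set mse beta N n psi | psi in
    [set psi | hermite_sobolev alpha L (pure_state psi)]].

End model.

Definition asymp_equiv (R : realType) (a b : nat -> R) : Prop :=
  exists c C : R, [/\ 0 < c, 0 < C &
    forall n : nat, (0 < n)%N -> c <= a n / b n <= C].

Definition truncation_exponent (R : realType) (alpha beta : R) : R :=
  if 2 * beta <= alpha then (4 * (alpha - beta))^-1 else (2 * alpha)^-1.

Definition eta2 (R : realType) (alpha beta : R) (n : nat) : R :=
  if 2 * beta <= alpha then n%:R^-1
  else n%:R `^ (- (2 * (1 - beta / alpha))).

(* Main.v *)
(* Only the probabilities p_j = |psi_j|^2 matter.  The estimator is the mean of
   the i.i.d. variables g(X_k), g(j) = j^(2 beta) for 1 <= j <= N and 0
   otherwise, so its risk is at most E g(X_1)^2 / n plus the squared bias.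
   The bias is sum_(j > N) p_j j^(2 beta) <= N^(-2 (alpha - beta)) L, and the second moment
   sum_(j <= N) p_j j^(4 beta) is at most L if 2 beta <= alpha and at most
   N^(4 beta - 2 alpha) L otherwise; the choice of N turns both into eta_n^2. *)
Require Import Defs.
From mathcomp Require Import all_boot all_order all_algebra.
From mathcomp Require Import sesquilinear complex.
From mathcomp Require Import all_classical all_reals all_analysis.
From mathcomp Require Import ring.

Import Order.TTheory GRing.Theory Num.Theory.
Import numFieldNormedType.Exports.

Local Open Scope classical_set_scope.
Local Open Scope ring_scope.

(** * Sums and integrals over tuples of natural numbers *)

Lemma esumZl (R : realType) (T : choiceType) (A : set T) (a : T -> \bar R)
    (c : R) : 0 <= c -> (forall x, 0 <= a x)%E ->
  (\esum_(x in A) (c%:E * a x) = c%:E * \esum_(x in A) a x)%E.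
Proof.
move=> c0 a0; rewrite /esum -ereal_supZl//; last first.
  by apply/set0P; eexists; exists set0 => //; exact: fsets_set0.
rewrite image_comp; congr ereal_sup; apply: eq_imagel => X _ /=.
by rewrite ge0_mule_fsumr.
Qed.

(** Tuples are countable, and a singleton is a finite intersection of preimages under the coordinate
    maps. *)
Lemma measurable_set_tuple n (A : set (n.-tuple nat)) : measurable A.
Proof.
apply: countable_measurable; last exact: countableP.
move=> t; rewrite (_ : [set t] =
    \bigcap_k ((@tnth n nat)^~ k @^-1` [set tnth t k])).
  apply: fin_bigcap_measurable => // k _; rewrite -[X in measurable X]setTI.
  exact: measurable_tnth.
apply/seteqP; split => [_ -> //|x xt].
by apply: eq_from_tnth => k; exact: xt.
Qed.

(** The fibres of [pickle] partition the space into countably many sets, each empty or a singleton,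
    and [h] is constant on each of them. *)
Lemma ge0_integral_tuple (R : realType) n
    (mu : {measure set (n.-tuple nat) -> \bar R}) (h : n.-tuple nat -> \bar R) :
  (forall x, 0 <= h x)%E ->
  (\int[mu]_x h x = \esum_(x in [set: n.-tuple nat]) (h x * mu [set x]))%E.
Proof.
move=> h0; pose F k := [set x : n.-tuple nat | pickle x = k].
have tF : trivIset setT F.
  by move=> i j _ _ [x [/= <- <-]].
have FT : [set: n.-tuple nat] = \bigcup_k F k.
  by apply/seteqP; split => // x _; exists (pickle x).
rewrite [in LHS]FT ge0_integral_bigcup//; first last.
- by move=> _ Y _; exact: measurable_set_tuple.
- by move=> k; exact: measurable_set_tuple.
rewrite [in RHS]FT nneseries_sum_bigcup//; last by move=> x; rewrite mule_ge0.
apply: eq_eseriesr => k _.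
have [[x Fkx]|Fk0] := pselect (exists x, F k x); last first.
  rewrite (_ : F k = set0) ?integral_set0 ?esum_set0//.
  by apply/seteqP; split => // x Fkx; apply: Fk0; exists x.
have -> : F k = [set x].
  apply/seteqP; split => [y Fky|_ ->//].
  by apply: (pcan_inj (@pickleK _)); rewrite Fkx Fky.
rewrite esum_set1 ?mule_ge0// -integral_cst; last exact: measurable_set_tuple.
by apply: eq_integral => y /[!inE] ->.
Qed.

(** Tonelli along the bijection between a tuple and its tail and head; this drives the inductions on
    the sample size. *)
Lemma esum_tuple_cons (R : realType) n (f : n.+1.-tuple nat -> \bar R) :
  (forall x, 0 <= f x)%E ->
  (\esum_(x in [set: n.+1.-tuple nat]) f x =
   \esum_(x in [set: n.-tuple nat]) \esum_(j in [set: nat])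
     f [tuple of j :: x])%E.
Proof.
move=> f0.
pose cns (u : n.-tuple nat * nat) : n.+1.-tuple nat := [tuple of u.2 :: u.1].
have bij_cns : set_bij [set: n.-tuple nat * nat] [set: n.+1.-tuple nat] cns.
  split => //.
    move=> [t i] [u j] _ _ /(congr1 val) [-> tu].
    by congr pair; apply: val_inj.
  by move=> x _; case/tupleP: x => j t; exists (t, j).
rewrite (reindex_esum _ _ _ _ bij_cns) esum_esum//.
by congr esum; apply/seteqP; split.
Qed.

(** * Moments of a sum of i.i.d. discrete variables *)

Section tuple_moments.
Local Set Implicit Arguments.
Context (R : realType) (p g : nat -> R) (m s : R).
Hypotheses (p_ge0 : forall j, 0 <= p j) (g_ge0 : forall j, 0 <= g j).
Hypothesis p_sum1 : (\esum_(j in [set: nat]) (p j)%:E = 1)%E.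
Hypothesis pg_sum : (\esum_(j in [set: nat]) (p j * g j)%:E = m%:E)%E.
Hypothesis pg2_sum : (\esum_(j in [set: nat]) (p j * g j ^+ 2)%:E = s%:E)%E.

Let pmf n (x : n.-tuple nat) : R := \prod_(k < n) p (tnth x k).
Let T n (x : n.-tuple nat) : R := \sum_(k < n) g (tnth x k).

Let pmf_ge0 n (x : n.-tuple nat) : 0 <= pmf x.
Proof. exact: prodr_ge0. Qed.

Let T_ge0 n (x : n.-tuple nat) : 0 <= T x.
Proof. exact: sumr_ge0. Qed.

Let pmf_cons n j (x : n.-tuple nat) : pmf [tuple of j :: x] = p j * pmf x.
Proof.
by rewrite /pmf big_ord_recl tnth0; under eq_bigr do rewrite tnthS.
Qed.

Let T_cons n j (x : n.-tuple nat) : T [tuple of j :: x] = g j + T x.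
Proof.
by rewrite /T big_ord_recl tnth0; under eq_bigr do rewrite tnthS.
Qed.

Let pmf_sum1 n : (\esum_(x in [set: n.-tuple nat]) (pmf x)%:E = 1)%E.
Proof.
apply: esum_tuple_prod => //.
by rewrite nneseries_esumT// => j; rewrite lee_fin.
Qed.

Let m_ge0 : 0 <= m.
Proof.
by rewrite -lee_fin -pg_sum esum_ge0// => j _; rewrite lee_fin mulr_ge0.
Qed.

Let s_ge0 : 0 <= s.
Proof.
rewrite -lee_fin -pg2_sum esum_ge0// => j _.
by rewrite lee_fin mulr_ge0// sqr_ge0.
Qed.

(** Induction on [n]: summing out the head [j] of [g j + T x] against [p j] leaves [m + T x]. *)
Lemma esum_tuple_mean n :
  (\esum_(x in [set: n.-tuple nat])
     ((\prod_(k < n) p (tnth x k)) * \sum_(k < n) g (tnth x k))%:E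
   = (n%:R * m)%:E)%E.
Proof.
under eq_esum do rewrite -/(pmf _) -/(T _).
elim: n => [|n IHn].
  by rewrite mul0r esum1// => x _; rewrite /T big_ord0 mulr0.
rewrite esum_tuple_cons => [|x]; last by rewrite lee_fin mulr_ge0.
transitivity (\esum_(x in [set: n.-tuple nat])
    ((pmf x * T x)%:E + m%:E * (pmf x)%:E))%E.
  apply: eq_esum => x _.
  transitivity (\esum_(j in [set: nat])
      ((pmf x)%:E * ((p j * g j)%:E + (T x)%:E * (p j)%:E)))%E.
    apply: eq_esum => j _; rewrite pmf_cons T_cons -!EFinM.
    by congr EFin; ring.
  rewrite esumZl//; last first.
    by move=> j; rewrite -EFinM -EFinD lee_fin addr_ge0 ?mulr_ge0.
  rewrite esumD ?esumZl//; first last.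
  all: try by move=> *; rewrite -?EFinM -?EFinD lee_fin
    ?addr_ge0 ?mulr_ge0 ?sqr_ge0.
  rewrite p_sum1 pg_sum mule1 -!EFinM.
  by congr EFin; ring.
rewrite esumD ?esumZl//; first last.
all: try by move=> *; rewrite -?EFinM -?EFinD lee_fin
    ?addr_ge0 ?mulr_ge0 ?sqr_ge0.
rewrite pmf_sum1 mule1 IHn -EFinD -natr1.
by congr EFin; ring.
Qed.

(** The [n] diagonal pairs contribute [s] each and the [n (n - 1)] independent pairs [m ^+ 2] each.
    The induction expands [(g j + T x) ^+ 2], and its cross term calls for the mean. *)
Lemma esum_tuple_second_moment n :
  (\esum_(x in [set: n.-tuple nat])
     ((\prod_(k < n) p (tnth x k)) * (\sum_(k < n) g (tnth x k)) ^+ 2)%:E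
   = (n%:R * s + n%:R * (n%:R - 1) * m ^+ 2)%:E)%E.
Proof.
under eq_esum do rewrite -/(pmf _) -/(T _).
elim: n => [|n IHn].
  by rewrite !mul0r addr0 esum1// => x _; rewrite /T big_ord0 expr0n mulr0.
rewrite esum_tuple_cons => [|x]; last by rewrite lee_fin mulr_ge0 ?sqr_ge0.
transitivity (\esum_(x in [set: n.-tuple nat])
    ((pmf x * T x ^+ 2)%:E +
     ((2 * m)%:E * (pmf x * T x)%:E + s%:E * (pmf x)%:E)))%E.
  apply: eq_esum => x _.
  transitivity (\esum_(j in [set: nat])
      ((pmf x)%:E * ((p j * g j ^+ 2)%:E +
        ((2 * T x)%:E * (p j * g j)%:E + (T x ^+ 2)%:E * (p j)%:E))))%E.
    apply: eq_esum => j _; rewrite pmf_cons T_cons -!EFinM.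
    by congr EFin; ring.
  rewrite esumZl//; last first.
    move=> j; rewrite -!EFinM -!EFinD lee_fin.
    by rewrite !addr_ge0 ?mulr_ge0 ?sqr_ge0.
  rewrite !esumD ?esumZl ?sqr_ge0 ?mulr_ge0//; first last.
  all: try by move=> *; rewrite -?EFinM -?EFinD lee_fin
    ?addr_ge0 ?mulr_ge0 ?sqr_ge0.
  rewrite p_sum1 pg_sum pg2_sum mule1 -!EFinM.
  by congr EFin; ring.
rewrite !esumD ?esumZl ?mulr_ge0//; first last.
all: try by move=> *; rewrite -?EFinM -?EFinD lee_fin
    ?addr_ge0 ?mulr_ge0 ?sqr_ge0.
rewrite pmf_sum1 mule1 IHn esum_tuple_mean -EFinM -!EFinD -natr1.
by congr EFin; ring.
Qed.

(* Moving the negative cross term of the square to the left keeps every sum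
   one of nonnegative terms. *)
Lemma esum_tuple_mse n f : (0 < n)%N -> 0 <= f ->
  (\esum_(x in [set: n.-tuple nat])
     ((\prod_(k < n) p (tnth x k)) *
      (n%:R^-1 * (\sum_(k < n) g (tnth x k)) - f) ^+ 2)%:E
   <= (s / n%:R + (f - m) ^+ 2)%:E)%E.
Proof.
move=> n0 f0; under eq_esum do rewrite -/(pmf _) -/(T _).
have nR : n%:R != 0 :> R by rewrite pnatr_eq0 -lt0n.
have : (\esum_(x in [set: n.-tuple nat])
      ((pmf x * (n%:R^-1 * T x - f) ^+ 2)%:E +
       (2 * f / n%:R)%:E * (pmf x * T x)%:E) =
    \esum_(x in [set: n.-tuple nat])
      ((n%:R^-2)%:E * (pmf x * T x ^+ 2)%:E + (f ^+ 2)%:E * (pmf x)%:E))%E.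
  apply: eq_esum => x _; rewrite -!EFinM -!EFinD; congr EFin; field.
  exact: nR.
rewrite !esumD ?esumZl ?mulr_ge0 ?sqr_ge0 ?invr_ge0 ?exprn_ge0//; first last.
all: try by move=> *; rewrite lee_fin mulr_ge0 ?sqr_ge0.
all: try by move=> *; rewrite -?EFinM -?EFinD lee_fin
    ?addr_ge0 ?mulr_ge0 ?sqr_ge0 ?invr_ge0 ?exprn_ge0.
rewrite esum_tuple_mean esum_tuple_second_moment pmf_sum1 mule1 -!EFinM -EFinD.
(* The right-hand side is finite, so the sum cannot be [+oo], and the cross term may now be
   subtracted in [R]. *)
case: (esum _ _) => // r; rewrite -EFinD => -[E].
rewrite lee_fin.
have -> : r = (n%:R ^- 2 * (n%:R * s + n%:R * (n%:R - 1) * m ^+ 2) + f ^+ 2)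
   - 2 * f / n%:R * (n%:R * m) by rewrite -E addrK.
rewrite -subr_ge0.
(* The exact variance is [(s - m ^+ 2) / n]; the bound gives away only its negative part. *)
set d := (X in 0 <= X); have -> : d = m ^+ 2 / n%:R by rewrite /d; field.
by rewrite mulr_ge0 ?sqr_ge0.
Qed.

End tuple_moments.

(** * Variance and bias of the truncated estimator *)

Section truncated_estimator.
Local Set Implicit Arguments.
Context (R : realType) (H : completeNormedModType R[i]).
Variables (dot : {dot H for Num.conj}) (e : nat -> H).

(** [coef2] is the diagonal entry <j|rho|j> of the operator. This matters because membership in the
    Sobolev class provides some unit vector with the same operator, not [psi] itself. *)
Lemma pure_state_coef2 (psi phi : H) :
  pure_state dot psi = pure_state dot phi -> coef2 dot e psi = coef2 dot e phi.
Proof.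
have coefE xi j :
    coef2 dot e xi j = complex.Re (dot (pure_state dot xi (e j)) (e j)).
  rewrite /pure_state linearZl_LR/= hermitian_subproof/= expr0 mul1r mulrC.
  by rewrite -normCK.
by move=> E; apply/funext => j; rewrite !coefE E.
Qed.

(** After exchanging the two sums, each observation meets at most one index [j] of the window. *)
Lemma F_hat_mean (beta : R) N n (x : n.-tuple nat) :
  F_hat beta N x = n%:R^-1 * \sum_(k < n)
    (if (0 < tnth x k <= N)%N then (tnth x k)%:R `^ (2 * beta) else 0).
Proof.
rewrite /F_hat /p_hat; under eq_bigr do rewrite -mulrA mulr_suml.
rewrite -mulr_sumr exchange_big/=; congr *%R; apply: eq_bigr => k _.
rewrite -[X in if X then _ else _]/(1 <= tnth x k < N.+1)%N.
rewrite -(big_nat1_eq +%R (fun j => j%:R `^ (2 * beta)) (tnth x k)).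
rewrite big_mkcond/=.
by apply: eq_bigr => j _; rewrite eq_sym; case: eqP; rewrite ?mul1r ?mul0r.
Qed.

Lemma mse_esum (beta : R) N n psi (f : R) :
  F_functional dot e beta psi = f%:E ->
  mse dot e beta N n psi =
  (\esum_(x in [set: n.-tuple nat])
     ((\prod_(k < n) coef2 dot e psi (tnth x k)) *
      (F_hat beta N x - f) ^+ 2)%:E)%E.
Proof.
move=> Ff; rewrite /mse ge0_integral_tuple; last first.
  by move=> x; rewrite Ff -EFinB -EFin_expe lee_fin sqr_ge0.
apply: eq_esum => x _.
rewrite [X in (_ * X)%E](_ : _ = (outcome_pmf dot e psi x)%:E).
  by rewrite outcome_pmfE Ff -EFinB -EFin_expe -EFinM mulrC.
by apply: esum_set1; rewrite lee_fin outcome_pmf_ge0.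
Qed.

Hypotheses (H_hilbert : hilbert_form dot) (e_basis : orthonormal_basis dot e).

(** Separates the probability from the choice of [N]: comparing weights pointwise with [j^(2 alpha)]
    costs a factor [K] inside the window, which bounds the second moment, and [B] beyond it, which
    bounds the bias. *)
Lemma mse_le (alpha beta L K B : R) N n psi : 0 < beta -> beta < alpha ->
  0 < L -> 0 <= K -> 0 <= B -> (0 < n)%N ->
  (forall j, (0 < j <= N)%N ->
    (j%:R `^ (2 * beta)) ^+ 2 <= K * j%:R `^ (2 * alpha)) ->
  (forall j, (N < j)%N -> j%:R `^ (2 * beta) <= B * j%:R `^ (2 * alpha)) ->
  hermite_sobolev dot e alpha L (pure_state dot psi) ->
  (mse dot e beta N n psi <= (K * L / n%:R + (B * L) ^+ 2)%:E)%E.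
Proof.
move=> beta0 ltba L0 K0 B0 n0 leK leB [phi [phiL phi1] phipsi].
pose p := coef2 dot e psi.
have pE : p = coef2 dot e phi by apply: pure_state_coef2.
have p0 j : 0 <= p j by exact: coef2_ge0.
have psum : (\esum_(j in [set: nat]) (p j)%:E = 1)%E.
  rewrite -nneseries_esumT => [|j]; last by rewrite lee_fin.
  by rewrite pE; exact: parseval.
pose w (s : R) j : R := j%:R `^ (2 * s).
have w0 s j : 0 <= w s j by exact: powR_ge0.
have weighted s xi : (weighted_sum dot e xi s =
    \esum_(j in [set: nat]) (coef2 dot e xi j * w s j)%:E)%E.
  by apply: nneseries_esumT => j; rewrite lee_fin mulr_ge0// coef2_ge0.
have {phiL} pL : (\esum_(j in [set: nat]) (p j * w alpha j)%:E <= L%:E)%E.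
  by rewrite pE -weighted.
have pdef : coef2 dot e psi = p by [].
clearbody p.
(* Domination by the Sobolev weights yields a real value and its bound at once; it is applied to the
   functional, the mean, the second moment and the bias. *)
have esum_fin (a : nat -> R) (c : R) : 0 <= c ->
    (forall j, 0 <= a j <= c * (p j * w alpha j)) ->
    exists2 r, (\esum_(j in [set: nat]) (a j)%:E = r%:E)%E & 0 <= r <= c * L.
  move=> c0 ac.
  have a0 : (0 <= \esum_(j in [set: nat]) (a j)%:E)%E.
    by apply: esum_ge0 => j _; rewrite lee_fin; case/andP: (ac j).
  have : (\esum_(j in [set: nat]) (a j)%:E <= (c * L)%:E)%E.
    apply: (@le_trans _ _
        (\esum_(j in [set: nat]) (c%:E * (p j * w alpha j)%:E))%E).
      by apply: le_esum => j _; rewrite -EFinM lee_fin; case/andP: (ac j).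
    rewrite esumZl//; last by move=> j; rewrite lee_fin mulr_ge0.
    by rewrite EFinM lee_wpmul2l.
  move: a0; case: esum => // r; rewrite !lee_fin => r0 rc.
  by exists r => //; rewrite r0.
pose g j : R := if (0 < j <= N)%N then w beta j else 0.
have g0 j : 0 <= g j by rewrite /g; case: ifP.
have gw j : g j <= w beta j by rewrite /g; case: ifP.
(* At [j = 0] both weights are 0, the exponents being nonzero; from [j = 1] on the power grows with
   its exponent. *)
have wab j : w beta j <= w alpha j.
  case: j => [|j]; last by rewrite ler_powR ?ler1n// ler_pM2l ?ltW.
  by rewrite /w !powR0 ?mulf_neq0 ?gt_eqF// (lt_trans beta0).
have [f pf _] : exists2 f, (\esum_(j in [set: nat]) (p j * w beta j)%:E
    = f%:E)%E & 0 <= f <= 1 * L.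
  by apply: esum_fin => // j /=; rewrite mul1r mulr_ge0// ler_wpM2l.
have [m pm /andP[m0 _]] : exists2 m, (\esum_(j in [set: nat])
    (p j * g j)%:E = m%:E)%E & 0 <= m <= 1 * L.
  apply: esum_fin => // j /=.
  by rewrite mul1r mulr_ge0// ler_wpM2l// (le_trans (gw j)).
have [s ps /andP[_ sKL]] : exists2 s, (\esum_(j in [set: nat])
    (p j * g j ^+ 2)%:E = s%:E)%E & 0 <= s <= K * L.
  apply: esum_fin => // j /=; rewrite mulr_ge0 ?sqr_ge0//=.
  rewrite [leRHS]mulrCA ler_wpM2l//.
  rewrite /g; case: ifP => [/leK//|_].
  by rewrite expr0n mulr_ge0.
have [b pb /andP[b0 bBL]] : exists2 b, (\esum_(j in [set: nat])
    (p j * (w beta j - g j))%:E = b%:E)%E & 0 <= b <= B * L.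
  apply: esum_fin => // j /=; rewrite mulr_ge0 ?subr_ge0//=.
  rewrite [leRHS]mulrCA ler_wpM2l//.
  rewrite /g; case: ifPn => [_|]; first by rewrite subrr mulr_ge0.
  (* The index 0 is also outside the window, but its weight vanishes, so only [j > N] needs [B]. *)
  rewrite subr0 negb_and -leqNgt leqn0 -ltnNge => /orP[/eqP ->|/leB//].
  by rewrite /w powR0 ?mulf_neq0 ?gt_eqF// mulr_ge0// powR_ge0.
have fmb : f = m + b.
  apply: EFin_inj; rewrite -pf EFinD -pm -pb -esumD => [|j _|j _].
  - by apply: eq_esum => j _; rewrite -EFinD; congr EFin; ring.
  - by rewrite lee_fin mulr_ge0.
  - by rewrite lee_fin mulr_ge0// subr_ge0.
rewrite (@mse_esum beta N n psi f); last first.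
  by rewrite /F_functional weighted pdef pf.
rewrite pdef.
under eq_esum do rewrite F_hat_mean.
have f0 : 0 <= f by rewrite fmb addr_ge0.
have := @esum_tuple_mse R p g m s p0 g0 psum pm ps n f n0 f0.
move=> /le_trans; apply; rewrite lee_fin lerD//.
  by rewrite ler_wpM2r// invr_ge0.
by rewrite fmb addrAC subrr add0r ler_sqr// nnegrE mulr_ge0// ltW.
Qed.

End truncated_estimator.

(** * Power functions and the rate of convergence *)

Lemma ler_powR_npos (R : realType) (x y r : R) :
  0 < x -> x <= y -> r <= 0 -> y `^ r <= x `^ r.
Proof.
move=> x0 xy r0; have y0 := lt_le_trans x0 xy.
rewrite -[r]opprK powRN [leRHS]powRN lef_pV2 ?posrE ?powR_gt0//.
by rewrite ge0_ler_powR ?oppr_ge0 ?nnegrE ?(ltW x0) ?(ltW y0).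
Qed.

Lemma powR_sqr (R : realType) (x r : R) : (x `^ r) ^+ 2 = x `^ (2 * r).
Proof. by rewrite [2 * r]mulrC powRrM powR_mulrn// powR_ge0. Qed.

Theorem theorem5p4 (R : realType) (alpha beta L : R)
  (beta_gt0 : 0 < beta) (beta_lt_alpha : beta < alpha) (L_gt0 : 0 < L)
  (H : completeNormedModType R[i]) (dot : {dot H for Num.conj})
  (H_hilbert : hilbert_form dot)
  (e : nat -> H) (e_basis : orthonormal_basis dot e)
  (N : nat -> nat) (N_gt0 : forall n : nat, (0 < n)%N -> (0 < N n)%N)
  (N_asymp : asymp_equiv (fun n => (N n)%:R : R)
               (fun n => n%:R `^ truncation_exponent alpha beta)) :
  exists C : R, 0 < C /\
    \forall n \near \oo,
      (max_risk dot e alpha L beta (N n) n <= (C * eta2 alpha beta n)%:E)%E.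
Proof.
have alpha_gt0 := lt_trans beta_gt0 beta_lt_alpha.
have [c [D [c0 D0 ND]]] := N_asymp.
set tau := truncation_exponent alpha beta in ND.
have leN n : (0 < n)%N -> c * n%:R `^ tau <= (N n)%:R <= D * n%:R `^ tau.
  move=> n0; have := ND _ n0.
  by rewrite ler_pdivlMr ?ler_pdivrMr// powR_gt0// ltr0n.
pose r := 2 * beta - 2 * alpha.
have r0 : r <= 0 by rewrite subr_le0 ler_pM2l// ltW.
have split_powR (j : nat) a b : (0 < j)%N ->
    j%:R `^ a = j%:R `^ (a - b) * j%:R `^ b :> R.
  by move=> j0; rewrite -powRD ?subrK// pnatr_eq0 -lt0n j0 implybT.
have leB n : (0 < n)%N -> forall j, (N n < j)%N ->
    j%:R `^ (2 * beta) <= (N n)%:R `^ r * j%:R `^ (2 * alpha) :> R.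
  move=> n0 j Nj; rewrite (split_powR j _ (2 * alpha)) ?(leq_ltn_trans _ Nj)//.
  rewrite ler_wpM2r ?powR_ge0// ler_powR_npos ?ltr0n ?N_gt0//.
  by rewrite ler_nat ltnW.
(* As [r] is nonpositive, the lower bound on [N n] is the one that controls the bias. *)
have bias_le n : (0 < n)%N ->
    ((N n)%:R `^ r * L) ^+ 2 <= (c `^ r * L) ^+ 2 * n%:R `^ (2 * (tau * r)).
  move=> n0; have n0R : 0 < n%:R :> R by rewrite ltr0n.
  have -> : (c `^ r * L) ^+ 2 * n%:R `^ (2 * (tau * r)) =
      ((c * n%:R `^ tau) `^ r * L) ^+ 2.
    rewrite -powR_sqr powRrM powRM ?powR_ge0 ?ltW//.
    by rewrite -exprMn; congr (_ ^+ 2); rewrite mulrAC.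
  rewrite ler_sqr ?nnegrE ?mulr_ge0 ?powR_ge0 ?(ltW L_gt0)//.
  rewrite ler_wpM2r ?(ltW L_gt0)// ler_powR_npos ?mulr_gt0 ?powR_gt0//.
  by case/andP: (leN _ n0).
have cL0 : 0 < (c `^ r * L) ^+ 2 by rewrite exprn_gt0// mulr_gt0// powR_gt0.
(* Common end of both regimes: it remains to choose the window factor [K n], bound the variance
   term, and check that the squared bias has the order of [eta2]. *)
have risk_le K E : 0 < E -> (forall n, (0 < n)%N -> 0 <= K n /\
      K n * L / n%:R <= E * eta2 alpha beta n) ->
    (forall n, (0 < n)%N -> forall j, (0 < j <= N n)%N ->
      (j%:R `^ (2 * beta)) ^+ 2 <= K n * j%:R `^ (2 * alpha)) ->
    (forall n, (0 < n)%N -> n%:R `^ (2 * (tau * r)) = eta2 alpha beta n) ->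
    exists C : R, 0 < C /\ \forall n \near \oo,
      (max_risk dot e alpha L beta (N n) n <= (C * eta2 alpha beta n)%:E)%E.
  move=> E0 KE leK etaE; exists (E + (c `^ r * L) ^+ 2).
  split; first by rewrite addr_gt0.
  exists 1%N => // n /= n0; apply: ge_ereal_sup => _ [psi psiL <-].
  have [Kn0 KnE] := KE n n0.
  have := @mse_le R H dot e H_hilbert e_basis alpha beta L (K n)
    ((N n)%:R `^ r) (N n) n psi beta_gt0 beta_lt_alpha L_gt0 Kn0
    (powR_ge0 _ _) n0 (leK n n0) (leB n n0) psiL.
  move=> /le_trans; apply; rewrite lee_fin mulrDl lerD//.
  by rewrite -etaE// bias_le.
have ba0 : alpha - beta != 0 by rewrite subr_eq0 gt_eqF.
have a0 : alpha != 0 by rewrite gt_eqF.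
have [ab|ab] := leP (2 * beta) alpha.
  have eta n : eta2 alpha beta n = n%:R^-1 by rewrite /eta2 ab.
  (* Here [4 beta <= 2 alpha], so the factor 1 suffices for [j >= 1]; and [tau * r = -1/2] gives a
     squared bias of order [1 / n]. *)
  apply: (risk_le (fun=> 1) L) => // [n n0|n n0 j /andP[j0 _]|n n0].
  - by split=> //; rewrite mul1r eta.
  - by rewrite mul1r powR_sqr ler_powR ?ler1n// ler_pM2l.
  - rewrite eta /tau /truncation_exponent ab -[n%:R^-1]powR_inv1//; congr powR.
    by rewrite /r; field.
have nab : (2 * beta <= alpha) = false by apply/negbTE; rewrite -ltNge.
have eta n : eta2 alpha beta n = n%:R `^ (- (2 * (1 - beta / alpha))).
  by rewrite /eta2 nab.
pose q := 2 * (2 * beta) - 2 * alpha.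
have q0 : 0 <= q by rewrite subr_ge0 ler_pM2l// ltW.
have tauE : tau = (2 * alpha)^-1 by rewrite /tau /truncation_exponent nab.
(* With [q >= 0], [j^q] is largest at [j = N n], and now the upper bound [D n^tau] on [N n] controls
   the variance. *)
apply: (risk_le (fun n => (N n)%:R `^ q) (D `^ q * L)) => [|n n0|n n0 j|n n0].
- by rewrite mulr_gt0// powR_gt0.
- split; first exact: powR_ge0.
  have n0R : 0 < n%:R :> R by rewrite ltr0n.
  have /andP[_ ND'] := leN _ n0.
  (* The exponents [tau * q - 1] and [2 * (tau * r)] both equal [-2 (1 - beta / alpha)]: variance
     bound and squared bias balance. *)
  have -> : eta2 alpha beta n = (n%:R `^ tau) `^ q * n%:R^-1.
    rewrite eta -[n%:R^-1]powR_inv1 ?ltW// -powRrM -powRD; last first.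
      by rewrite pnatr_eq0 -lt0n n0 implybT.
    by congr powR; rewrite tauE /q; field.
  rewrite mulrA ler_pM2r ?invr_gt0// mulrAC ler_pM2r//.
  rewrite -powRM ?powR_ge0 ?(ltW D0)//.
  by rewrite ge0_ler_powR ?nnegrE ?mulr_ge0 ?powR_ge0 ?(ltW D0).
- move=> /andP[j0 jN]; rewrite powR_sqr (split_powR j _ (2 * alpha))//.
  by rewrite ler_wpM2r ?powR_ge0// ge0_ler_powR ?nnegrE ?ler_nat.
- by rewrite eta tauE /r; congr powR; field.
Qed.
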